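(* Let $\mathrm{SYSTEM}:=\max_{w\in\mathcal W}\frac1N\sum_{j=1}^N U(\langle w,\widehat x^\star_j\rangle)$ and, for $\varepsilon>0$, $$\mathtt{POA}(\varepsilon)=\frac{\mathrm{SYSTEM}-g^*(\varepsilon)}{\mathrm{SYSTEM}},\qquad \mathtt{POA}_{\rm noise}(\varepsilon)=\frac{\mathrm{SYSTEM}-g^*_{\rm noise}(\varepsilon)}{\mathrm{SYSTEM}},$$ where $g^*(\varepsilon)$ and $g^*_{\rm noise}(\varepsilon)$ are the optimal values of the direct and the noisy-data DRO problems. If $\mathrm{SYSTEM}>0$, then: (i) $\mathtt{POA}(\varepsilon)$ and $\mathtt{POA}_{\rm noise}(\varepsilon)$ are nondecreasing in $\varepsilon$; (ii) if the noise is mean-preserving, i.e. $\mathbb E^{\mathbb O(\cdot\mid x)}[X^\star\mid X=x]=x$ for all $x\in\mathfrak X$, then for every $\varepsilon>0$, $\mathtt{POA}(\varepsilon)\ge\mathtt{POA}_{\rm noise}(\varepsilon)$.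
   Context: Setting. $\mathfrak X=\{x\in\mathbb R^n: x_{\min}\le x\le x_{\max}\}$ (componentwise) is a compact box, and $\mathfrak X^\star\subseteq\mathbb R^n$ is a compact convex set with $\mathfrak X\subseteq\mathfrak X^\star$. The noise is additive: the noisy observation of a latent vector $X$ is $X^\star=X+E$ with $E$ independent of $X$, $E\sim\mathbb F_E$, $\mathbb E\|E\|<\infty$; the known noise kernel is $\mathbb O(A\mid x)=\mathbb P(X^\star\in A\mid X=x)=\mathbb F_E(A-x)$, where $A-x=\{z:z+x\in A\}$, and for each $x\in\mathfrak X$ it is supported on $\mathfrak X^\star$. $\widehat x^\star_1,\dots,\widehat x^\star_N\in\mathfrak X^\star$ are the observed noisy samples. $\|\cdot\|$ is the $\ell_1$-norm. $\mathcal W\subseteq\mathbb R^n$ is a compact set of decisions and $U:\mathbb R\to\mathbb R$ is continuous, concave and nondecreasing. Noisy-data DRO problem. $g^*_{\rm noise}(\varepsilon)$ is the optimal value of $$\sup_{w\in\mathcal W,\ \lambda\ge0,\ a_1,\dots,a_N\in\mathbb R}\ -\lambda\varepsilon+\frac1N\sum_{j=1}^N a_j\quad\text{s.t.}\quad \inf_{x\in\mathfrak X}\left(U(\langle w,x\rangle)+\lambda\int_{\mathfrak X^\star}\|x^\star-\widehat x^\star_j\|\,d\mathbb O(x^\star\mid x)\right)\ge a_j,\ \ j=1,\dots,N.$$ Direct DRO problem (the observed noisy samples are treated as if noise-free). $g^*(\varepsilon)$ is the optimal value of $$\sup_{w\in\mathcal W,\ \lambda\ge0,\ a_1,\dots,a_N\in\mathbb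 R}\ -\lambda\varepsilon+\frac1N\sum_{j=1}^N a_j\quad\text{s.t.}\quad \inf_{x\in\mathfrak X}\left(U(\langle w,x\rangle)+\lambda\|x-\widehat x^\star_j\|\right)\ge a_j,\ \ j=1,\dots,N.$$ Optimal values, and hence $\mathtt{POA}$ and $\mathtt{POA}_{\rm noise}$, are understood as extended real numbers. *)

(* Defs.v *)
From HB Require Import structures.
From mathcomp Require Import all_boot all_order all_algebra.
From mathcomp Require Import all_classical all_reals all_analysis.

Set Implicit Arguments.
Unset Strict Implicit.
Unset Printing Implicit Defensive.

Import Order.TTheory GRing.Theory Num.Theory.
Import numFieldNormedType.Exports.

Local Open Scope classical_set_scope.
Local Open Scope ring_scope.

(* [borel_rV R n] is 'rV[R]_n with its Borel sigma-algebra. *)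
Definition borel_rV (R : realType) (n : nat) :=
  g_sigma_algebraType (@open 'rV[R]_n).

Definition dotv (R : realType) (n : nat) (w x : 'rV[R]_n) : R :=
  \sum_(i < n) w 0 i * x 0 i.

(* The library norm on 'rV[R]_n is the sup norm; it is only used for its
   topology. *)
Definition l1norm (R : realType) (n : nat) (x : 'rV[R]_n) : R :=
  \sum_(i < n) `|x 0 i|.

Definition box (R : realType) (n : nat) (xmin xmax : 'rV[R]_n) :
    set 'rV[R]_n :=
  [set x | forall i, xmin 0 i <= x 0 i <= xmax 0 i].

Definition concave (R : realType) (U : R -> R) : Prop :=
  convex_function [set: R^o] (fun t => - U t).

Definition independent_RV (R : realType) (d d1 d2 : measure_display)
    (T : measurableType d) (T1 : measurableType d1) (T2 : measurableType d2)
    (P : probability T R) (X : {RV P >-> T1}) (Y : {RV P >-> T2}) : Prop :=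
  forall (A : set T1) (B : set T2), measurable A -> measurable B ->
    (P (X @^-1` A `&` Y @^-1` B) = P (X @^-1` A) * P (Y @^-1` B))%E.

Definition translation (R : realType) (n : nat) (x : 'rV[R]_n) :
    borel_rV R n -> borel_rV R n :=
  fun z => (z : 'rV[R]_n) + x.

Lemma measurable_translation (R : realType) (n : nat) (x : 'rV[R]_n) :
  measurable_fun [set: borel_rV R n] (translation x).
Proof.
apply: (@measurability _ _ (borel_rV R n) (borel_rV R n) setT _
  (@open 'rV[R]_n)) => //.
move=> _ [A oA <-]; rewrite setTI; apply: sub_sigma_algebra.
have cx : continuous (fun z : 'rV[R]_n => z + x).
  by move=> z; exact: (cvgD (@cvg_id _ (nbhs z)) (cvg_cst x)).
by move/continuousP: cx; exact.
Qed.

HB.instance Definition _ (R : realType) (n : nat) (x : 'rV[R]_n) :=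
  isMeasurableFun.Build _ _ _ _ (translation x) (measurable_translation x).

(* O(A | x) = F {z | z + x \in A}. *)
Definition noise_kernel (R : realType) (n : nat)
    (F : probability (borel_rV R n) R) (x : 'rV[R]_n) :=
  distribution F (translation x).

HB.instance Definition _ (R : realType) (n : nat)
    (F : probability (borel_rV R n) R) (x : 'rV[R]_n) :=
  Probability.on (noise_kernel F x).

Definition mean_preserving (R : realType) (n : nat) (D : set 'rV[R]_n)
    (F : probability (borel_rV R n) R) : Prop :=
  forall x, D x -> forall i : 'I_n,
    (\int[noise_kernel F x]_xs ((xs : 'rV[R]_n) 0 i)%:E = (x 0 i)%:E)%E.

(* The two problems differ only in the transport cost [c j x] between the
   j-th sample and the point x. *)
Definition dro_feasible (R : realType) (n N : nat) (W D : set 'rV[R]_n)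
    (U : R -> R) (c : 'I_N -> 'rV[R]_n -> \bar R)
    (w : 'rV[R]_n) (lambda : R) (a : 'I_N -> R) : Prop :=
  [/\ W w, 0 <= lambda &
      forall j, ((a j)%:E <=
        ereal_inf [set (U (dotv w x))%:E + lambda%:E * c j x | x in D])%E].

Definition dro_objective (R : realType) (N : nat) (eps lambda : R)
    (a : 'I_N -> R) : R :=
  - lambda * eps + N%:R^-1 * \sum_(j < N) a j.

Definition dro_value (R : realType) (n N : nat) (W D : set 'rV[R]_n)
    (U : R -> R) (c : 'I_N -> 'rV[R]_n -> \bar R) (eps : R) : \bar R :=
  ereal_sup [set v | exists w lambda a,
    dro_feasible W D U c w lambda a /\ v = (dro_objective eps lambda a)%:E].

Definition direct_cost (R : realType) (n N : nat) (xhat : 'I_N -> 'rV[R]_n)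
    (j : 'I_N) (x : 'rV[R]_n) : \bar R :=
  (l1norm (x - xhat j))%:E.

Definition noisy_cost (R : realType) (n N : nat) (Dstar : set 'rV[R]_n)
    (F : probability (borel_rV R n) R) (xhat : 'I_N -> 'rV[R]_n)
    (j : 'I_N) (x : 'rV[R]_n) : \bar R :=
  (\int[noise_kernel F x]_(xs in Dstar) (l1norm ((xs : 'rV[R]_n) - xhat j))%:E)%E.

Definition g_direct (R : realType) (n N : nat) (W D : set 'rV[R]_n)
    (U : R -> R) (xhat : 'I_N -> 'rV[R]_n) (eps : R) : \bar R :=
  dro_value W D U (direct_cost xhat) eps.

Definition g_noise (R : realType) (n N : nat) (W D Dstar : set 'rV[R]_n)
    (U : R -> R) (F : probability (borel_rV R n) R)
    (xhat : 'I_N -> 'rV[R]_n) (eps : R) : \bar R :=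
  dro_value W D U (noisy_cost Dstar F xhat) eps.

Definition avg_utility (R : realType) (n N : nat) (U : R -> R)
    (xhat : 'I_N -> 'rV[R]_n) (w : 'rV[R]_n) : R :=
  N%:R^-1 * \sum_(j < N) U (dotv w (xhat j)).

(* The supremum is a maximum, see [SYSTEM_max]; for W empty it is 0. *)
Definition SYSTEM (R : realType) (n N : nat) (W : set 'rV[R]_n)
    (U : R -> R) (xhat : 'I_N -> 'rV[R]_n) : R :=
  sup [set avg_utility U xhat w | w in W].

Lemma continuous_avg_utility (R : realType) (n N : nat) (U : R -> R)
    (xhat : 'I_N -> 'rV[R]_n) :
  continuous U -> continuous (avg_utility U xhat).
Proof.
move=> cU w; have FF : Filter (nbhs w) := @nbhs_filter 'rV[R]_n w.
have sum_cvg m (f : 'I_m -> 'rV[R]_n -> R) :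
    (forall i, f i v @[v --> w] --> f i w) ->
    \sum_(i < m) f i v @[v --> w] --> \sum_(i < m) f i w.
  move=> cf; apply: (@cvg_big _ _ _ _ xpredT (@add_continuous _) _ (nbhs w)
    (index_enum 'I_m) f (f^~ w) _ (fun i _ => cf i)).
have dot_cvg j : dotv v (xhat j) @[v --> w] --> dotv w (xhat j).
  apply: sum_cvg => i.
  exact: (cvgM (@coord_continuous _ _ _ 0 i w) (cvg_cst (xhat j 0 i))).
have U_cvg j : U (dotv v (xhat j)) @[v --> w] --> U (dotv w (xhat j)).
  exact: (cvg_comp _ _ (dot_cvg j) (cU _)).
have cN := @cvg_cst R (N%:R^-1 : R) 'rV[R]_n (nbhs w) FF.
exact: (@cvgM R _ (nbhs w) FF _ _ _ _ cN (sum_cvg N _ U_cvg)).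
Qed.

Lemma SYSTEM_max (R : realType) (n N : nat) (W : set 'rV[R]_n)
    (U : R -> R) (xhat : 'I_N -> 'rV[R]_n) :
  compact W -> W !=set0 -> continuous U ->
  exists w, [/\ W w, SYSTEM W U xhat = avg_utility U xhat w &
    forall w', W w' -> avg_utility U xhat w' <= avg_utility U xhat w].
Proof.
move=> cW W0 cU.
have [w] := EVT_max_rV W0 cW
  (continuous_subspaceT (continuous_avg_utility (xhat := xhat) cU)).
rewrite inE => Ww wmax; exists w; split=> //; last first.
  by move=> w' Ww'; apply: wmax; rewrite inE.
apply/eqP; rewrite eq_le; apply/andP; split.
  apply: ge_sup; first by exists (avg_utility U xhat w), w.
  by move=> _ [w' Ww' <-]; apply: wmax; rewrite inE.
apply: ub_le_sup; last by exists w.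
by exists (avg_utility U xhat w) => _ [w' Ww' <-]; apply: wmax; rewrite inE.
Qed.

Definition relative_gap (R : realType) (S : R) (g : \bar R) : \bar R :=
  ((S%:E - g) / S%:E)%E.

Definition POA (R : realType) (n N : nat) (W D : set 'rV[R]_n)
    (U : R -> R) (xhat : 'I_N -> 'rV[R]_n) (eps : R) : \bar R :=
  relative_gap (SYSTEM W U xhat) (g_direct W D U xhat eps).

Definition POA_noise (R : realType) (n N : nat) (W D Dstar : set 'rV[R]_n)
    (U : R -> R) (F : probability (borel_rV R n) R)
    (xhat : 'I_N -> 'rV[R]_n) (eps : R) : \bar R :=
  relative_gap (SYSTEM W U xhat) (g_noise W D Dstar U F xhat eps).

(* Main.v *)
(* The objective is nonincreasing in the radius because [lambda >= 0], hence so
   are both optimal values. When the noise is mean-preserving, Jensen's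
   inequality applied to each coordinate gives
   [`|x - xhat_j| <= \int `|xs - xhat_j| dO(xs | x)], so every point feasible
   for the direct problem is feasible for the noisy one. *)

Require Import Defs.
From HB Require Import structures.
From mathcomp Require Import all_boot all_order all_algebra.
From mathcomp Require Import all_classical all_reals all_analysis.
From mathcomp Require Import measurable_realfun.

Set Implicit Arguments.
Unset Strict Implicit.
Unset Printing Implicit Defensive.

Import Order.TTheory GRing.Theory Num.Theory.
Import numFieldNormedType.Exports.

Local Open Scope classical_set_scope.
Local Open Scope ring_scope.

Lemma measurable_coord (R : realType) (n : nat) (i : 'I_n) :
  measurable_fun [set: borel_rV R n] (fun x => (x : 'rV[R]_n) 0 i).
Proof.
apply: (measurability _ (RGenOpens.measurableE R)) => _ [_ [a [b ->]] <-].
rewrite setTI; apply: sub_sigma_algebra.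
have /continuousP := @coord_continuous R 1 n 0 i.
by apply; exact: interval_open.
Qed.

Lemma compact_measurable_rV (R : realType) (n : nat) (K : set 'rV[R]_n) :
  compact K -> measurable (K : set (borel_rV R n)).
Proof.
move=> cK; rewrite -[K]setCK; apply: measurableC.
apply: sub_sigma_algebra; apply: closed_openC.
exact: (compact_closed (@norm_hausdorff _ _)).
Qed.

(** Jensen's inequality for [|. - c|], obtained from the triangle inequality for the integral of
    [f - c]. *)
Lemma le_abs_mean_dev d (T : measurableType d) (R : realType)
    (P : probability T R) (f : T -> R) (m c : R) :
  measurable_fun setT f -> (\int[P]_t (f t)%:E = m%:E)%E ->
  (`|m - c|%:E <= \int[P]_t `|f t - c|%:E)%E.
Proof.
move=> mf fm.
pose g : T -> R := f \- cst c.
have mg : measurable_fun setT (EFin \o g).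
  exact/measurable_EFinP/measurable_funB.
(* An infinite right-hand side is trivial; a finite one is exactly the integrability of [g]. *)
have [->|] := eqVneq (\int[P]_t `|f t - c|%:E)%E +oo%E; first exact: leey.
rewrite -ltey => fin.
have ig : P.-integrable setT (EFin \o g).
  by apply/integrableP; split.
have ic : P.-integrable setT (EFin \o cst c).
  exact: finite_measure_integrable_cst.
have -> : (`|m - c|%:E = `| \int[P]_t (f t - c)%:E |)%E.
  suff -> : (\int[P]_t (f t - c)%:E = (m - c)%:E)%E by [].
  (* Additivity is applied to [f = (f - c) + c], whose two summands are known to be integrable; the
     constant integrates to [c] because [P] has mass 1. *)
  have : (\int[P]_t (f t)%:E = \int[P]_t (f t - c)%:E + c%:E)%E.
    rewrite -[X in (_ + X)%E]mule1 -(@probability_setT _ _ _ P).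
    rewrite -(integral_cst P measurableT) -(integralD measurableT ig ic).
    by apply: eq_integral => t _; rewrite /= -EFinD subrK.
  by rewrite fm => /esym/eqP; rewrite EFinB eq_sym => /eqP ->; rewrite addeK.
exact: (le_abse_integral P measurableT mg).
Qed.

Section dro_value_monotone.
Variables (R : realType) (n N : nat) (W D : set 'rV[R]_n) (U : R -> R).

Lemma dro_value_le_eps (c : 'I_N -> 'rV[R]_n -> \bar R) (eps1 eps2 : R) :
  eps1 <= eps2 -> (dro_value W D U c eps2 <= dro_value W D U c eps1)%E.
Proof.
move=> le12; apply: ge_ereal_sup => _ [w [l [a [fe ->]]]].
(* Feasibility does not involve the radius, so the same point competes for [eps1]. *)
apply: (@le_trans _ _ (dro_objective eps1 l a)%:E).
  by case: fe => _ l0 _; rewrite lee_fin lerD2r ler_wnM2l// oppr_le0.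
by apply: ereal_sup_ubound; exists w, l, a.
Qed.

(** A larger cost raises the infimum in each constraint, as [lambda >= 0], and leaves the objective
    unchanged. The infimum ranges over [D] only, so costs need comparing only there. *)
Lemma dro_value_le_cost (c1 c2 : 'I_N -> 'rV[R]_n -> \bar R) (eps : R) :
  (forall j x, D x -> (c1 j x <= c2 j x)%E) ->
  (dro_value W D U c1 eps <= dro_value W D U c2 eps)%E.
Proof.
move=> le12; apply: ereal_sup_le => _ [w [l [a [[Ww l0 fe] ->]]]].
exists w, l, a; split => //; split=> // j; apply: le_trans (fe j) _.
apply: le_ereal_inf_tmp => _ [x Dx <-].
apply: (@le_trans _ _ ((U (dotv w x))%:E + l%:E * c1 j x)%E).
  by apply: ereal_inf_lbound; exists x.
by rewrite leeD2l// lee_wpmul2l// ?lee_fin// le12.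
Qed.

End dro_value_monotone.

Lemma relative_gap_le (R : realType) (S : R) (g1 g2 : \bar R) :
  0 < S -> (g2 <= g1)%E -> (relative_gap S g1 <= relative_gap S g2)%E.
Proof.
(* As [S] is nonzero, its extended inverse is the real one, a nonnegative factor. *)
move=> S0 le21; rewrite /relative_gap inver gt_eqF//.
by rewrite lee_wpmul2r ?leeB// lee_fin invr_ge0 ltW.
Qed.

Lemma direct_cost_le_noisy_cost (R : realType) (n N : nat)
    (D Dstar : set 'rV[R]_n) (F : probability (borel_rV R n) R)
    (xhat : 'I_N -> 'rV[R]_n) (j : 'I_N) (x : 'rV[R]_n) :
  compact Dstar -> mean_preserving D F -> D x ->
  noise_kernel F x Dstar = 1%E ->
  (direct_cost xhat j x <= noisy_cost Dstar F xhat j x)%E.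
Proof.
move=> /compact_measurable_rV mDs mp Dx supp.
have mcoord i : measurable_fun [set: borel_rV R n]
    (fun y => `|(y : 'rV[R]_n) 0 i - xhat j 0 i|%:E).
  apply/measurable_EFinP/measurableT_comp => //.
  by apply: measurable_funB => //; exact: measurable_coord.
(* The mean is taken over the whole space but the cost over [Dstar]; a null complement reconciles
   the two. *)
have nullC : noise_kernel F x (~` Dstar) = 0%E.
  apply: (etrans (probability_setC (noise_kernel F x) mDs)).
  by apply: (etrans (congr1 (fun p => 1 - p)%E supp)); rewrite subee.
rewrite /direct_cost /noisy_cost /l1norm.
under eq_integral do rewrite -sumEFin.
(* The l1-norm splits into coordinates; nonnegativity allows the exchange even if the cost is
   infinite. *)
rewrite ge0_integral_sum//; last first.
  by move=> i; under eq_fun do rewrite !mxE; exact: measurable_funTS.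
rewrite -sumEFin; apply: lee_sum => i _; rewrite !mxE.
under eq_integral do rewrite !mxE.
(* [Dstar] is rewritten as the whole space minus the null set, which is then put back. *)
rewrite -[X in integral _ X]setCK -setTD -ge0_negligible_integral//.
- exact: (le_abs_mean_dev _ (@measurable_coord R n i) (mp x Dx i)).
- exact: measurableC.
Qed.

Theorem lemma4p2 (R : realType) (n N : nat)
    (xmin xmax : 'rV[R]_n) (Dstar : set 'rV[R]_n)
    (d : measure_display) (T : measurableType d) (P : probability T R)
    (X E : {RV P >-> borel_rV R n}) (F : probability (borel_rV R n) R)
    (xhat : 'I_N -> 'rV[R]_n) (W : set 'rV[R]_n) (U : R -> R)
    (hN : (0 < N)%N)
    (hDstar_compact : compact Dstar)
    (hDstar_convex : @convex_set R 'rV[R]_n Dstar)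
    (hD_sub : box xmin xmax `<=` Dstar)
    (h_indep : independent_RV X E)
    (hE_law : forall A : set (borel_rV R n), measurable A ->
        distribution P E A = F A)
    (hE_int : ('E_P[fun t => l1norm (E t : 'rV[R]_n)] < +oo)%E)
    (h_supp : forall x, box xmin xmax x -> noise_kernel F x Dstar = 1%E)
    (hxhat : forall j, Dstar (xhat j))
    (hW : compact W)
    (hU_cont : continuous U)
    (hU_concave : concave U)
    (hU_mono : {homo U : s t / s <= t})
    (hSYSTEM : 0 < SYSTEM W U xhat) :
  ((forall eps1 eps2 : R, 0 < eps1 -> eps1 <= eps2 ->
      (POA W (box xmin xmax) U xhat eps1
        <= POA W (box xmin xmax) U xhat eps2)%E) /\
   (forall eps1 eps2 : R, 0 < eps1 -> eps1 <= eps2 ->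
      (POA_noise W (box xmin xmax) Dstar U F xhat eps1
        <= POA_noise W (box xmin xmax) Dstar U F xhat eps2)%E)) /\
  (mean_preserving (box xmin xmax) F ->
   forall eps : R, 0 < eps ->
     (POA_noise W (box xmin xmax) Dstar U F xhat eps
        <= POA W (box xmin xmax) U xhat eps)%E).
Proof.
split; first split.
- move=> eps1 eps2 _ le12; apply: relative_gap_le => //.
  exact: dro_value_le_eps.
- move=> eps1 eps2 _ le12; apply: relative_gap_le => //.
  exact: dro_value_le_eps.
(* The gap reverses order, so the direct value must be at most the noisy one. *)
- move=> mp eps _; apply: relative_gap_le => //.
  apply: dro_value_le_cost => j x Dx.
  exact: (direct_cost_le_noisy_cost _ _ hDstar_compact mp Dx (h_supp x Dx)).
Qed.
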